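(* For every finite simple undirected graph $G$, the clean-factor series $(G_i)_{i\ge 1}$ generated by $G$ terminates; that is, there is some $i\ge 1$ such that $G_i$ is defined and the clean-factor factorisation of $G_i$ is not effective (it creates no new vertex).
   Context: All graphs are finite, undirected and simple. A $k$-partite graph $G=(V_0,\ldots,V_{k-1},E)$ is a graph together with an ordered partition $(V_0,\ldots,V_{k-1})$ of its vertex set into $k$ non-empty parts (levels) such that every edge joins vertices in different parts. $N(x)$ is the neighbourhood of $x$ and $N_i(x)=N(x)\cap V_i$. Factorisation. Given a $k$-partite graph $G=(V_0,\ldots,V_{k-1},E)$ with $k\ge 2$ and a set $V'_k$ of subsets of $V(G)$, the factorisation of $G$ with respect to $V'_k$ is the graph $G'=(V_0,\ldots,V_k,E\cup E_+)$, where the new level $V_k$ is the set of inclusion-maximal elements of $V'_k$ and $E_+=\{Xy \mid X\in V_k,\ y\in X\}$. It is called effective if $V_k\neq\emptyset$. The set $V^+_k$. For a $k$-partite graph, $V^+_k$ is the set of all sets $\{x_1,\ldots,x_l\}\cup\bigcap_{1\le i\le l}N(x_i)$ where $l\ge 2$, $x_1,\ldots,x_l$ are distinct elements of $V_{k-1}$, and $|\bigcap_{1\le i\le l}N(x_i)|\ge 2$. The set $V^*_k$. - If $k\ge 5$: $V^*_k$ is the set of $X\in V^+_k$ such that $|\bigcap_{x\in X\cap V_{k-1}}N_{k-2}(x)|\ge 2$, and $N_{k-3}(x)=N_{k-3}(y)$ for all $x,y\in X\cap V_{k-1}$, and $|\bigcap_{x\in X\cap V_{k-1}}N_1(x)|\ge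 2$. - If $k=4$: $V^*_4$ is the set of $X\in V^+_4$ such that $|\bigcap_{x\in X\cap V_3}N_2(x)|\ge 2$, $|\bigcap_{x\in X\cap V_3}N_1(x)|\ge 2$, and $N_0(x)=N_0(y)$ for all $x,y\in X\cap V_3$. - If $k=3$: $V^*_3$ is the set of $X\in V^+_3$ such that $|\bigcap_{x\in X\cap V_2}N_1(x)|\ge 2$ and $|\bigcap_{x\in X\cap V_2}N_0(x)|\ge 2$. - If $k=2$: $V^*_2=V^+_2$. The clean-factor graph of a $k$-partite graph is its factorisation with respect to $V^*_k$. Clean-factor series of a graph $G$. $\mathcal{K}(G)$ is the set of maximal cliques of $G$. $G_1=B(G)$ is the vertex-clique-incidence bipartite graph: level $V_0=V(G)$, level $V_1=\mathcal{K}(G)$, with an edge $vC$ whenever $v\in C$. For $i\ge 1$, $G_{i+1}$ is the clean-factor graph of $G_i$ if that factorisation is effective, and is undefined otherwise (as are then all subsequent graphs). *)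

(* Defs.v *)
From mathcomp Require Import all_boot.

Set Implicit Arguments.
Unset Strict Implicit.
Unset Printing Implicit Defensive.

Record sgraph := SGraph {
  svertex :> finType;
  sedge : rel svertex;
  sedge_sym : symmetric sedge;
  sedge_irrefl : irreflexive sedge
}.

Definition clique (G : sgraph) (C : {set G}) : bool :=
  [forall x in C, forall y in C, (x != y) ==> sedge x y].

Definition max_cliques (G : sgraph) : {set {set G}} :=
  [set C | maxset (@clique G) C].

(* The ordered partition is given by its level function: the part V_i is
   [part H i].  Non-emptiness of the parts is not a field, so that the bipartite
   graph of the graph without vertices is covered as well; for a graph with at
   least one vertex it holds throughout the series, see
   [clean_factor_series_parts]. *)
Record kpartite := KPartite {
  kgraph :> sgraph;
  nparts : nat;
  level : kgraph -> nat;
  level_lt : forall x, level x < nparts;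
  level_edge : forall x y, sedge x y -> level x != level y
}.

Definition part (H : kpartite) (i : nat) : {set H} := [set x | level x == i].

Definition nbh (H : kpartite) (x : H) : {set H} := [set y | sedge x y].

Definition nbh_part (H : kpartite) (i : nat) (x : H) : {set H} :=
  nbh x :&: part H i.

(* Adding to H one new level whose vertices are the members of A, each joined to
   its own elements. *)
Section AddLevel.
Variables (H : kpartite) (A : {set {set H}}).

Definition add_vertex : finType := (H + {X : {set H} | X \in A})%type.

Definition add_edge (u v : add_vertex) : bool :=
  match u, v with
  | inl x, inl y => sedge x y
  | inl x, inr Y => x \in val Y
  | inr X, inl y => y \in val X
  | inr _, inr _ => false
  end.

Definition add_lev (u : add_vertex) : nat :=
  match u with inl x => level x | inr _ => nparts H end.

Lemma add_edge_sym : symmetric add_edge.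
Proof. by case=> [x|X] [y|Y] //=; rewrite sedge_sym. Qed.

Lemma add_edge_irrefl : irreflexive add_edge.
Proof. by case=> [x|X] //=; rewrite sedge_irrefl. Qed.

Lemma add_lev_lt u : add_lev u < (nparts H).+1.
Proof. by case: u => [x|X] //=; rewrite ltnS ltnW ?level_lt. Qed.

Lemma add_lev_edge u v : add_edge u v -> add_lev u != add_lev v.
Proof.
case: u v => [x|X] [y|Y] //=; first exact: level_edge.
  by move=> _; rewrite neq_ltn level_lt.
by move=> _; rewrite neq_ltn level_lt orbT.
Qed.

Definition add_level : kpartite :=
  @KPartite (SGraph add_edge_sym add_edge_irrefl) (nparts H).+1 add_lev
    add_lev_lt add_lev_edge.

End AddLevel.

Definition maximal_sets (H : kpartite) (A : {set {set H}}) : {set {set H}} :=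
  [set X | maxset [in A] X].

Definition factorisation (H : kpartite) (A : {set {set H}}) : kpartite :=
  add_level (maximal_sets A).

Definition effective (H : kpartite) (A : {set {set H}}) : bool :=
  maximal_sets A != set0.

Definition Vplus (H : kpartite) : {set {set H}} :=
  [set S :|: \bigcap_(x in S) nbh x | S : {set H}
     & [&& S \subset part H (nparts H - 1), 2 <= #|S|
         & 2 <= #|\bigcap_(x in S) nbh x|]].

(* The elements of X in V_{k-1}; for X in [Vplus H] these are the chosen
   x_1, ..., x_l, as a vertex has no neighbour in its own part. *)
Definition top_part (H : kpartite) (X : {set H}) : {set H} :=
  X :&: part H (nparts H - 1).

Definition two_common (H : kpartite) (i : nat) (X : {set H}) : bool :=
  2 <= #|\bigcap_(x in top_part X) nbh_part i x|.

Definition same_nbh (H : kpartite) (i : nat) (X : {set H}) : bool :=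
  [forall x in top_part X, forall y in top_part X, nbh_part i x == nbh_part i y].

(* Only nparts H >= 2 is meaningful. *)
Definition Vstar (H : kpartite) : {set {set H}} :=
  match nparts H with
  | 0 | 1 | 2 => Vplus H
  | 3 => [set X in Vplus H | two_common 1 X && two_common 0 X]
  | 4 => [set X in Vplus H
           | [&& two_common 2 X, two_common 1 X & same_nbh 0 X]]
  | k => [set X in Vplus H
           | [&& two_common (k - 2) X, same_nbh (k - 3) X & two_common 1 X]]
  end.

Definition clean_factor (H : kpartite) : kpartite := factorisation (Vstar H).

Section Incidence.
Variable G : sgraph.

Definition no_edge : rel G := fun _ _ => false.

Lemma no_edge_sym : symmetric no_edge. Proof. by []. Qed.
Lemma no_edge_irrefl : irreflexive no_edge. Proof. by []. Qed.
Lemma no_edge_lt (x : G) : 0 < 1. Proof. by []. Qed.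
Lemma no_edge_level (x y : G) : no_edge x y -> 0 != 0. Proof. by []. Qed.

Definition edgeless : kpartite :=
  @KPartite (SGraph no_edge_sym no_edge_irrefl) 1 (fun=> 0)
    no_edge_lt no_edge_level.

(* The vertex-clique-incidence graph: V(G) with its edges forgotten is level 0,
   and the added level 1 consists of the maximal cliques of G. *)
Definition incidence : kpartite := @add_level edgeless (max_cliques G).

End Incidence.

Definition clean_step (H : kpartite) : option kpartite :=
  if effective (Vstar H) then Some (clean_factor H) else None.

(* The graph G_i, with None when it is undefined; numbering starts at i = 1. *)
Definition clean_factor_series (G : sgraph) (i : nat) : option kpartite :=
  if i is j.+1 then iter j (obind clean_step) (Some (incidence G)) else None.

Lemma add_level_parts (H : kpartite) (A : {set {set H}}) :
    A != set0 -> (forall j, j < nparts H -> part H j != set0) ->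
  forall j, j < (nparts H).+1 -> part (add_level A) j != set0.
Proof.
move=> /set0Pn[X XA] Hne j; rewrite ltnS leq_eqVlt => /predU1P[->|/Hne].
  by apply/set0Pn; exists (inr (exist _ X XA)); rewrite inE /=.
case/set0Pn=> x; rewrite inE => xj.
by apply/set0Pn; exists (inl x); rewrite inE.
Qed.

Lemma clean_factor_series_parts (G : sgraph) (i : nat) (H : kpartite) :
    0 < #|G| -> clean_factor_series G i = Some H ->
  nparts H = i.+1 /\ forall j, j < nparts H -> part H j != set0.
Proof.
move=> G0; case: i => // i; elim: i H => [|i IH] H /=.
  case=> <-; split=> //; apply: add_level_parts.
    have [|C Cmax _] := @maxset_exists _ (@clique G) set0.
      by apply/forall_inP=> x; rewrite inE.
    by apply/set0Pn; exists C; rewrite inE.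
  case=> // _; case/card_gt0P: G0 => x _.
  by apply/set0Pn; exists x; rewrite inE.
rewrite /= in IH; case E: (iter _ _ _) => [K|] //=; rewrite /clean_step.
have [kK Kne] := IH K E.
case: ifP => // eff [<-]; split; first by rewrite /= kK.
exact: add_level_parts.
Qed.

(* Main.v *)
Require Import Defs.
From mathcomp Require Import all_boot zify.

(* For a vertex x at level k write D_j(x) for its neighbours at level j < k.
   Every x at level k >= 2 is a maximal set S + N(S) with S = D_{k-1}(x), and for
   k >= 5 all members of S have the same D_{k-3}.  By induction on k >= 4 one
   shows that some z in D_{k-2}(x) satisfies D_j(z) <= D_j(x) for all j < k-2 with
   j <> 1; it is the vertex generated by the common set D_{k-3}, and maximality
   puts it below x.  Hence D_j(x) is recovered from D_{k-2}(x) when j <> 1, and x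
   is determined by D_{k-2}(x) and D_1(x).  The members of D_k(x), for x at level
   k+1 >= 5, share D_{k-2}, so two of them differ in D_1, and one has a D_1 strictly
   containing D_1(x).  Thus |D_1| drops by at least 1 per level, while it is
   bounded by the number of maximal cliques of G.  (Behind this: the vertices at
   level k are the strict chains of length k-1 in the poset formed by level 2.) *)

Set Implicit Arguments.
Unset Strict Implicit.
Unset Printing Implicit Defensive.

(* The part on which [Vstar] requires equal neighbourhoods, for k >= 4. *)
Definition frozen_part k : nat := if k == 4 then 0 else k - 3.

Lemma frozen_part_neq1 k : 4 <= k -> frozen_part k != 1.
Proof. by rewrite /frozen_part; case: (eqVneq k 4) => // k4 ?; apply/eqP; lia. Qed.

Lemma frozen_part_lt k : 4 <= k -> frozen_part k < k - 2.
Proof. by rewrite /frozen_part; case: (eqVneq k 4) => [->|] //; lia. Qed.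

(** * Lower neighbourhoods and what maximality says about them *)

Section Below.
Variable H : kpartite.
Implicit Types (x y z : H) (S T : {set H}) (i j k : nat).

Definition below x : {set H} := [set y | sedge x y && (level y < level x)].

Definition upper x : {set H} := below x :&: part H (level x).-1.

Definition common S : {set H} := \bigcap_(x in S) below x.

(* The sets S for which S :|: common S belongs to V*_k.  For k = 2 the members of S
   have all their lower neighbours in part 0, so [adm_two] is the condition of V+_2. *)
Record admissible k S : Prop := Admissible {
  adm_sub : S \subset part H k.-1;
  adm_card : 2 <= #|S|;
  adm_two : 2 <= #|common S :&: part H (k - 2)|;
  adm_one : 3 <= k -> 2 <= #|common S :&: part H 1|;
  adm_zero : k <= 3 -> 2 <= #|common S :&: part H 0|;
  adm_frozen : 4 <= k -> {in S &, forall x y,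
    below x :&: part H (frozen_part k) = below y :&: part H (frozen_part k)}
}.

(** All that is kept of the factorisation: the vertices at level [k] are the maximal closures
    [S :|: common S] of admissible [S]. Inclusion of closures is written as two inclusions, because
    [S] and [common S] lie in disjoint parts. *)
Record clean_level k : Prop := CleanLevel {
  cl_adm : forall x, level x = k -> admissible k (upper x);
  cl_below : forall x, level x = k -> below x = upper x :|: common (upper x);
  cl_max : forall x T, level x = k -> admissible k T ->
    upper x \subset T -> common (upper x) \subset common T -> T \subset upper x;
  cl_ex : forall T, admissible k T ->
    exists2 x, level x = k & T \subset upper x /\ common T \subset common (upper x);
  cl_inj : forall x y, level x = k -> level y = k -> upper x = upper y -> x = y
}.

Definition clean : Prop := forall k, 2 <= k < nparts H -> clean_level k.

Lemma commonP S y : reflect (forall x, x \in S -> y \in below x) (y \in common S).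
Proof. exact: bigcapP. Qed.

Lemma common_anti S T : S \subset T -> common T \subset common S.
Proof.
move=> /subsetP ST; apply/subsetP => y /commonP yT.
by apply/commonP => x /ST/yT.
Qed.

Lemma in_upper x y : (y \in upper x) = (y \in below x) && (level y == (level x).-1).
Proof. by rewrite !inE. Qed.

Lemma upper_below x y : y \in upper x -> y \in below x.
Proof. by rewrite in_upper => /andP[]. Qed.

Lemma level_upper x y : y \in upper x -> level y = (level x).-1.
Proof. by rewrite in_upper => /andP[_ /eqP]. Qed.

Lemma level_below x y : y \in below x -> level y < level x.
Proof. by rewrite inE => /andP[]. Qed.

Lemma below_partE i x y :
  (y \in below x :&: part H i) = (y \in below x) && (level y == i).
Proof. by rewrite !inE. Qed.

Lemma admissible_sub k S T :
  S \subset T -> 2 <= #|S| -> admissible k T -> admissible k S.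
Proof.
move=> sST S2 [T1 _ T3 T4 T5 T6].
have cTS i : #|common T :&: part H i| <= #|common S :&: part H i|.
  by apply/subset_leq_card/setSI/common_anti.
split=> //.
- exact: subset_trans T1.
- exact: leq_trans (cTS _).
- by move=> /T4 /leq_trans -> //; apply: cTS.
- by move=> /T5 /leq_trans -> //; apply: cTS.
- by move=> /T6 TT x y /(subsetP sST) xT /(subsetP sST) yT; apply: TT.
Qed.

Hypothesis cleanH : clean.

Lemma level_clean x : 2 <= level x -> clean_level (level x).
Proof. by move=> x2; apply: cleanH; rewrite x2 level_lt. Qed.

Lemma upper_adm x : 2 <= level x -> admissible (level x) (upper x).
Proof. by move=> /level_clean/cl_adm; apply. Qed.

Lemma belowE x : 2 <= level x -> below x = upper x :|: common (upper x).
Proof. by move=> /level_clean/cl_below; apply. Qed.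

Lemma upper_ex x : 2 <= level x -> exists y, y \in upper x.
Proof.
by move=> /upper_adm/adm_card S2; apply/card_gt0P; rewrite (leq_trans _ S2).
Qed.

Lemma common_below x : 2 <= level x -> common (upper x) \subset below x.
Proof. by move=> x2; rewrite belowE // subsetUr. Qed.

Lemma below_common x y :
  2 <= level x -> y \in below x -> level y < (level x).-1 -> y \in common (upper x).
Proof.
move=> x2; rewrite belowE // inE => /orP[/level_upper-> |//].
by rewrite ltnn.
Qed.

Lemma level_common x y : 2 <= level x -> y \in common (upper x) -> level y < (level x).-1.
Proof.
move=> x2 /commonP yc; have [z zx] := upper_ex x2.
by rewrite -(level_upper zx); apply/level_below/yc.
Qed.

Lemma below_upper x y z : 2 <= level x -> z \in upper x -> y \in below x ->
  level y < level z -> y \in below z.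
Proof.
move=> x2 zx yx; rewrite (level_upper zx) => /(below_common x2 yx)/commonP.
exact.
Qed.

(** Any [w] in [upper x] has both [z] and [y] below it, with [z] in [upper w]; so [below_upper] is
    applied once at [x] and once at [w]. *)
Lemma below_upper2 x y z : 3 <= level x -> z \in below x -> level z = level x - 2 ->
  y \in below x -> level y < level z -> y \in below z.
Proof.
move=> x3 zx lz yx lyz.
have [w wx] := @upper_ex x (ltnW x3).
have lw := level_upper wx.
have zw : z \in below w by apply: below_upper wx zx _; lia.
have yw : y \in below w by apply: below_upper wx yx _; lia.
apply: below_upper yw lyz; first by lia.
by rewrite in_upper zw; lia.
Qed.

Lemma common_upper x y : y \in common (upper x) -> 2 <= level x -> y \in below x.
Proof. by move=> yx /common_below/subsetP; apply. Qed.

(** By admissibility a frozen neighbour of one member of [upper x] is a neighbour of all, hence lies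
    in [common (upper x)]. *)
Lemma frozen_below x y : 4 <= level x -> y \in upper x ->
  below y :&: part H (frozen_part (level x)) = below x :&: part H (frozen_part (level x)).
Proof.
move=> x4 yx; apply/setP => u; rewrite !below_partE.
case: eqP => lu; rewrite ?andbF // !andbT.
have x2 : 2 <= level x by lia.
have lux : level u < (level x).-1 by rewrite lu /frozen_part; case: eqP; lia.
apply/idP/idP => [uy|ux]; last first.
  by apply: (below_upper x2 yx) ux _; rewrite (level_upper yx).
apply: common_upper => //; apply/commonP => z zx.
have /setP/(_ u) := adm_frozen (upper_adm x2) x4 yx zx.
by rewrite !below_partE lu eqxx uy !andbT.
Qed.

(** * Absorption by maximality, and pivots *)

Lemma upper_absorb x y : 2 <= level x -> level y = (level x).-1 ->
    common (upper x) \subset below y ->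
    (4 <= level x -> below y :&: part H (frozen_part (level x)) =
                     below x :&: part H (frozen_part (level x))) ->
  y \in upper x.
Proof.
move=> x2 ly cy frz.
have [A1 A2 A3 A4 A5 A6] := upper_adm x2.
have cT : common (upper x) \subset common (y |: upper x).
  apply/subsetP => u ux; apply/commonP => z /setU1P.
  by case=> [->|]; [apply: (subsetP cy) | move/commonP: ux; apply].
have cTi i : #|common (upper x) :&: part H i| <= #|common (y |: upper x) :&: part H i|.
  by apply/subset_leq_card/setSI.
have sT : upper x \subset y |: upper x by apply: subsetUr.
suff adT : admissible (level x) (y |: upper x).
  have /subsetP := cl_max (level_clean x2) erefl adT sT cT.
  by apply; rewrite setU11.
split.
- by rewrite subUset A1 andbT sub1set inE ly.
- by apply: leq_trans (subset_leq_card sT).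
- exact: leq_trans (cTi _).
- by move=> /A4 /leq_trans -> //; apply: cTi.
- by move=> /A5 /leq_trans -> //; apply: cTi.
- move=> x4; have E u : u \in y |: upper x ->
    below u :&: part H (frozen_part (level x)) = below x :&: part H (frozen_part (level x)).
    by case/setU1P => [->|/frozen_below]; [apply: frz | apply].
  by move=> u v /E-> /E->.
Qed.

(* In terms of chains, x = (a_1 < ... < a_{k-1}) and z is its truncation
   (a_1 < ... < a_{k-3}). *)
Definition pivot x z :=
  [/\ z \in below x, level z = level x - 2
    & forall y, y \in below z -> level y != 1 -> y \in below x].

(* The pivot is generated by the level-1 common neighbours of D_0(x). *)
Lemma pivot4 x : level x = 4 -> exists z, pivot x z.
Proof.
move=> x4; have x2 : 2 <= level x by lia.
have [x0 x0x] := upper_ex x2; have lx0 := level_upper x0x.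
pose S0 := below x :&: part H 0.
pose T := [set t in part H 1 | S0 \subset below t].
have SE w : w \in upper x -> below w :&: part H 0 = S0.
  by move=> /frozen_below; rewrite x4; apply.
have S0b w s : w \in upper x -> s \in S0 -> s \in below w /\ level s = 0.
  by move=> /SE <-; rewrite below_partE => /andP[-> /eqP].
(* This makes [T] large enough to be admissible, and later carries common neighbours of [T] up to
   [x]. *)
have upT w z : w \in upper x -> z \in upper w -> upper z \subset T.
  move=> wx zw; have := (level_upper wx, level_upper zw) => -[lw lz].
  apply/subsetP => t tz; have lt := level_upper tz.
  rewrite !inE; apply/andP; split; first by apply/eqP; lia.
  apply/subsetP => s /(S0b _ _ wx)[sw s0].
  have sz : s \in below z by apply: (below_upper _ zw) => //; lia.
  by apply: (below_upper _ tz) => //; lia.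
have x02 : 2 <= level x0 by lia.
have [z0 z0x0] := upper_ex x02; have lz0 := level_upper z0x0.
have z02 : 2 <= level z0 by lia.
have cTS : S0 \subset common T :&: part H 0.
  apply/subsetP => s sS; have [_ ls] := S0b _ _ x0x sS.
  rewrite in_setI [_ \in part _ _]inE ls eqxx andbT; apply/commonP => t.
  by rewrite inE => /andP[_ /subsetP]; apply.
(* [S0] is the level-0 neighbourhood of [x0], which has level 3, where two common neighbours in part
   0 are required. *)
have S02 : 2 <= #|common T :&: part H 0|.
  apply: leq_trans (subset_leq_card cTS); rewrite -(SE x0) //.
  apply: leq_trans (adm_zero (upper_adm x02) _) _; first by lia.
  exact/subset_leq_card/setSI/common_below.
have adT : admissible 2 T.
  split=> //; first by apply/subsetP => t; rewrite inE => /andP[].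
  apply: leq_trans (subset_leq_card (upT _ _ x0x z0x0)).
  exact: adm_card (upper_adm z02).
have cl2 : clean_level 2 by apply: cleanH; have := level_lt x; lia.
have [z lz [sTz cTz]] := cl_ex cl2 adT.
have z2 : 2 <= level z by lia.
(* Absorption at level 3, where nothing is frozen: a common neighbour of [upper w] at level 0 lies
   in [S0], and one at level 1 is adjacent to all of [S0], hence lies in [T]. *)
have zw w : w \in upper x -> z \in upper w.
  move=> wx; have lw := level_upper wx; have w2 : 2 <= level w by lia.
  apply: upper_absorb => //; [lia | | lia].
  apply/subsetP => u uw; have lu := level_common w2 uw.
  have ubw := common_upper uw w2.
  have [u0|u1] : level u = 0 \/ level u = 1 by move: lu lw x4; clear; lia.
    apply: common_upper z2; apply: (subsetP cTz).
    have /(subsetP cTS) : u \in S0 by rewrite -(SE w) // below_partE ubw u0.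
    by rewrite inE => /andP[].
  apply: upper_below; apply: (subsetP sTz); rewrite !inE u1 /=.
  apply/subsetP => s /(S0b _ _ wx)[sw s0].
  by apply: (below_upper2 _ _ _ sw) => //; move: lw x4 u1 s0; clear; lia.
exists z; split; last 1 first.
(* Here [y] has level 0 and is common to [T], hence to [upper v] for every [v] two levels below [x];
   it then climbs from [v] to [w] to [x]. *)
- move=> y yz y1; have ly := level_below yz.
  apply: common_upper x2; apply/commonP => w wx; have lw := level_upper wx.
  apply: common_upper; last by lia.
  apply/commonP => v vw; have lv := level_upper vw.
  apply: common_upper; last by lia.
  apply: (subsetP (common_anti (upT _ _ wx vw))).
  apply: (subsetP (common_anti sTz)).
  by apply: below_common => //; lia.
- apply: common_upper x2; apply/commonP => w /zw; exact: upper_below.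
- by rewrite x4 lz.
Qed.

Lemma pivot_ex x : 4 <= level x -> exists z, pivot x z.
Proof.
have [n] := ubnP (level x); elim: n x => // n IH x lxn x4.
have [/pivot4 //|x5] : level x = 4 \/ 5 <= level x by lia.
have x2 : 2 <= level x by lia.
have fx : frozen_part (level x) = level x - 3 by rewrite /frozen_part; case: eqP; lia.
pose S0 := below x :&: part H (level x - 3).
have SE w : w \in upper x -> below w :&: part H (level x - 3) = S0.
  by move=> /frozen_below; rewrite fx; apply; lia.
have S0b w s : w \in upper x -> s \in S0 -> s \in below w /\ level s = level x - 3.
  by move=> /SE <-; rewrite below_partE => /andP[-> /eqP].
have sS0 w v : w \in upper x -> v \in upper w -> S0 \subset upper v.
  move=> wx vw; have := (level_upper wx, level_upper vw) => -[lw lv].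
  apply/subsetP => s /(S0b _ _ wx)[sw ls].
  rewrite in_upper; apply/andP; split; last by apply/eqP; lia.
  by apply: (below_upper _ vw sw); lia.
have [w0 w0x] := upper_ex x2; have lw0 := level_upper w0x.
have w02 : 2 <= level w0 by lia.
have [v0 v0w0] := upper_ex w02; have lv0 := level_upper v0w0.
have v02 : 2 <= level v0 by lia.
have S02 : 2 <= #|S0|.
  rewrite -(SE w0) //; have := adm_two (upper_adm w02).
  have -> : level w0 - 2 = level x - 3 by lia.
  move/leq_trans; apply; exact/subset_leq_card/setSI/common_below.
have adS0 := admissible_sub (sS0 _ _ w0x v0w0) S02 (upper_adm v02).
have [z lz [sSz cSz]] := cl_ex (level_clean v02) adS0.
have z2 : 2 <= level z by lia.
(* The pivot [u] of [w] is in [S0], and [y] is common to [S0], so [y] is below [u]; the pivot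
   property lifts it to [w]. *)
have zbelow w y : w \in upper x -> y \in below z -> level y < level x - 3 ->
    level y != 1 -> y \in below w.
  move=> wx yz ly y1; have lw := level_upper wx.
  have [|| u [uw lu piv]] := IH w; [lia | lia |].
  apply: piv => //.
  have /commonP : y \in common S0.
    by apply: (subsetP (common_anti sSz)); apply: below_common => //; lia.
  by apply; rewrite -(SE w) // below_partE uw; apply/eqP; lia.
(* At level [level x - 3] such a [u] is in [S0]; further down it is below every member of [S0] by
   [below_upper2]. *)
have belowz w u : w \in upper x -> u \in common (upper w) -> u \in below z.
  move=> wx uw; have lw := level_upper wx; have w2 : 2 <= level w by lia.
  have lu := level_common w2 uw; have ubw := common_upper uw w2.
  have [lu3|lu3] : level u = level x - 3 \/ level u < level x - 3 by lia.
    apply/upper_below/(subsetP sSz).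
    by rewrite -(SE w) // below_partE ubw lu3 eqxx.
  apply: common_upper z2; apply/(subsetP cSz)/commonP => s /(S0b _ _ wx)[sw ls].
  by apply: (below_upper2 _ _ _ ubw) => //; move: lw x5 ls lu3; clear; lia.
have zw w : w \in upper x -> z \in upper w.
  move=> wx; have lw := level_upper wx; have w2 : 2 <= level w by lia.
  apply: upper_absorb => //; first by lia.
    by apply/subsetP => u; apply: belowz.
  move=> w4; apply/setP => y; rewrite !below_partE.
  case: eqP => ly; rewrite ?andbF // !andbT.
  have [ly1 ly3] : level y != 1 /\ level y < level x - 3.
    by rewrite ly frozen_part_neq1 //; have := frozen_part_lt w4; lia.
  apply/idP/idP => [yz|yw]; first exact: zbelow.
  by apply: belowz wx _; apply: below_common => //; lia.
exists z; split; last 1 first.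
- move=> y yz y1; have ly := level_below yz.
  apply: common_upper x2; apply/commonP => w wx; have lw := level_upper wx.
  have [ly3|ly3] : level y < level x - 3 \/ level y = level x - 3 by lia.
    exact: zbelow.
  (* Now [y] is in [upper z], possibly outside [S0]; absorption puts it into [upper v] for every [v]
     two levels below [x]. *)
  have yuz : y \in upper z by rewrite in_upper yz; apply/eqP; lia.
  apply: common_upper; last by lia.
  apply/commonP => v vw; have lv := level_upper vw.
  apply/upper_below/upper_absorb; [lia | lia | |].
    apply/subsetP => u uv.
    have /(subsetP cSz)/commonP : u \in common S0.
      by apply: (subsetP (common_anti (sS0 _ _ wx vw))).
    exact.
  move=> v4; have [s sS] : exists s, s \in S0.
    by apply/card_gt0P; rewrite (leq_trans _ S02).
  have sz := subsetP sSz _ sS; have sv := subsetP (sS0 _ _ wx vw) _ sS.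
  have lvz : level v = level z by rewrite lz lv lw lv0 lw0.
  have z4 : 4 <= level z by rewrite -lvz.
  by rewrite -(frozen_below v4 sv) lvz (frozen_below z4 yuz) (frozen_below z4 sz).
- apply: common_upper x2; apply/commonP => w /zw; exact: upper_below.
- by lia.
Qed.

(** * Two levels determine a vertex; the bound on levels *)

(** For the remaining [j], the pivot of [y] is also below [x], as [x] and [y] agree two levels down.
    Neighbours of [x] at level [j] are then below that pivot, which hands them to [y]. *)
Lemma below_det x y j : 4 <= level x -> level y = level x ->
    below x :&: part H (level x - 2) = below y :&: part H (level x - 2) ->
    below x :&: part H 1 = below y :&: part H 1 ->
  j <= level x - 2 -> below x :&: part H j \subset below y.
Proof.
move=> x4 lyx E2 E1 jx; apply/subsetP => u; rewrite below_partE => /andP[ux /eqP lu].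
have [j2|j2] := eqVneq j (level x - 2).
  suff : u \in below y :&: part H (level x - 2) by rewrite below_partE => /andP[].
  by rewrite -E2 below_partE ux lu j2 eqxx.
have [j1|j1] := eqVneq j 1.
  suff : u \in below y :&: part H 1 by rewrite below_partE => /andP[].
  by rewrite -E1 below_partE ux lu j1 eqxx.
have [|z [zy lz piv]] := @pivot_ex y; first by lia.
apply: piv; last by rewrite lu.
have : z \in below x :&: part H (level x - 2).
  by rewrite E2 below_partE zy lz lyx eqxx.
rewrite below_partE => /andP[zx _].
by apply: (below_upper2 _ zx) => //; lia.
Qed.

Lemma upper_det x y : 4 <= level x -> level y = level x ->
    below x :&: part H (level x - 2) = below y :&: part H (level x - 2) ->
    below x :&: part H 1 = below y :&: part H 1 ->
  upper x \subset upper y.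
Proof.
move=> x4 lyx E2 E1; apply/subsetP => u ux; have lu := level_upper ux.
have y2 : 2 <= level y by lia.
have xy j : j <= level x - 2 -> below x :&: part H j = below y :&: part H j.
  move=> jx; apply/eqP; rewrite eqEsubset !subsetI !subsetIr !andbT.
  rewrite below_det //=; apply: below_det; rewrite ?lyx //; lia.
apply: upper_absorb => //; first by lia.
  apply/subsetP => v vy; have lv := level_common y2 vy.
  have vby := common_upper vy y2.
  have : v \in below x :&: part H (level v) by rewrite xy ?below_partE ?vby ?eqxx //; lia.
  rewrite below_partE => /andP[vx _].
  by apply: (below_upper _ ux) => //; lia.
move=> _; rewrite -xy ?lyx ?frozen_below //.
by have := frozen_part_lt x4; lia.
Qed.

Lemma vertex_det x y : 4 <= level x -> level y = level x ->
    below x :&: part H (level x - 2) = below y :&: part H (level x - 2) ->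
    below x :&: part H 1 = below y :&: part H 1 ->
  x = y.
Proof.
move=> x4 lyx E2 E1; apply: (cl_inj (level_clean _) erefl lyx); first by lia.
by apply/eqP; rewrite eqEsubset !upper_det // lyx.
Qed.

Lemma below1_shrinks x : 5 <= level x ->
  exists2 y, level y = (level x).-1
    & #|below x :&: part H 1| < #|below y :&: part H 1|.
Proof.
move=> x5; have x2 : 2 <= level x by lia.
have sub y : y \in upper x -> below x :&: part H 1 \subset below y :&: part H 1.
  move=> yx; apply/subsetP => u; rewrite !below_partE => /andP[ux u1].
  rewrite u1 andbT; apply: (below_upper _ yx ux) => //.
  by rewrite (eqP u1) (level_upper yx); lia.
have /card_gt1P[y [z [yx zx yz]]] := adm_card (upper_adm x2).
have := (level_upper yx, level_upper zx) => -[ly lz].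
suff [Ey|Ez] : below x :&: part H 1 != below y :&: part H 1 \/
    below x :&: part H 1 != below z :&: part H 1.
- by exists y => //; apply: proper_card; rewrite properEneq Ey sub.
- by exists z => //; apply: proper_card; rewrite properEneq Ez sub.
apply/orP; rewrite -negb_and; apply: contra yz => /andP[/eqP Ey /eqP Ez].
apply/eqP/vertex_det; rewrite -?Ey ?lz ?ly //; first by lia.
have := adm_frozen (upper_adm x2) (ltnW x5) yx zx.
rewrite /frozen_part; have -> : (level x == 4) = false by apply/eqP; lia.
by have -> : (level x).-1 - 2 = level x - 3 by lia.
Qed.

Lemma level_bound x : level x <= #|part H 1| + 4.
Proof.
(* The sum on the left does not decrease when passing from [x] to the [y] of [below1_shrinks]; the
   constant 4 is the level where the descent stops. *)
suff [//|x4] : level x < 4 \/ level x + #|below x :&: part H 1| <= #|part H 1| + 4.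
  by move=> ?; lia.
  by lia.
have [n] := ubnP (level x); elim: n x => // n IH x lxn.
have [?|x4] := ltnP (level x) 4; [by left | right].
have [e|x5] : level x = 4 \/ 5 <= level x by lia.
  by rewrite e addnC leq_add2r; apply/subset_leq_card/subsetIr.
have [y ly lt] := below1_shrinks x5.
have [||] := IH y; lia.
Qed.

End Below.

(** * Adding a level leaves the lower levels unchanged *)

Lemma imset_subset (T T' : finType) (f : T -> T') (S1 S2 : {set T}) :
  injective f -> (f @: S1 \subset f @: S2) = (S1 \subset S2).
Proof.
move=> fI; apply/idP/idP => [/subsetP sub|]; last exact: imsetS.
by apply/subsetP => x xS; rewrite -(mem_imset _ _ fI) sub ?imset_f.
Qed.

Lemma card_gt1_neq0 (T : finType) (S : {set T}) : 1 < #|S| -> S != set0.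
Proof. by move=> S2; rewrite -card_gt0 ltnW. Qed.

Section AddLevel.
Variables (H : kpartite) (A : {set {set H}}).
Implicit Types (x : H) (S : {set H}).

Let H' := add_level A.
Let old (x : H) : H' := inl x.

Let old_inj : injective old. Proof. by move=> x y []. Qed.

Lemma below_old x : below (old x) = old @: below x.
Proof.
apply/setP => -[y|Y]; first by rewrite (mem_imset _ _ old_inj) !inE.
rewrite inE /= ltnNge [level x <= _]ltnW ?level_lt // andbF.
by apply/esym/imsetP => -[].
Qed.

Lemma below_new (X : {X : {set H} | X \in A}) : @below H' (inr X) = old @: val X.
Proof.
apply/setP => -[y|Y]; first by rewrite (mem_imset _ _ old_inj) !inE /= level_lt andbT.
by rewrite inE /=; apply/esym/imsetP => -[].
Qed.

Lemma part_old k : k < nparts H -> part H' k = old @: part H k.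
Proof.
move=> kn; apply/setP => -[y|Y]; first by rewrite (mem_imset _ _ old_inj) !inE.
by rewrite inE /= gtn_eqF //; apply/esym/imsetP => -[].
Qed.

Lemma below_part_old x k : k < nparts H ->
  below (old x) :&: part H' k = old @: (below x :&: part H k).
Proof.
by move=> kn; rewrite below_old part_old // imsetI // => ? ? _ _; apply: old_inj.
Qed.

(** The empty intersection is the whole vertex set, added vertices included; hence the
    hypothesis. *)
Lemma common_old S : S != set0 -> common (old @: S) = old @: common S.
Proof.
case/set0Pn => s sS; apply/setP => y.
apply/commonP/imsetP => [yS|[z /commonP zS -> _ /imsetP[x xS ->]]]; last first.
  by rewrite below_old imset_f ?zS.
have := yS _ (imset_f old sS); rewrite below_old => /imsetP[z _ yz].
exists z => //; apply/commonP => x xS.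
by have := yS _ (imset_f old xS); rewrite below_old yz (mem_imset _ _ old_inj).
Qed.

Lemma common_part_old S k : k < nparts H -> S != set0 ->
  common (old @: S) :&: part H' k = old @: (common S :&: part H k).
Proof.
by move=> kn Sn; rewrite common_old // part_old // imsetI // => ? ? _ _; apply: old_inj.
Qed.

Lemma card_part_old k : k < nparts H -> #|part H' k| = #|part H k|.
Proof. by move=> /part_old->; rewrite card_imset. Qed.

(** Admissibility at [k] mentions only parts of index below [k], so [k = nparts H], the index of the
    added level, is covered too. *)
Lemma admissible_old k S : 2 <= k <= nparts H ->
  admissible k (old @: S) <-> admissible k S.
Proof.
case/andP=> k2 kn.
have n0 : 0 < nparts H by lia.
have kf : 4 <= k -> frozen_part k < nparts H by move/frozen_part_lt; lia.
split=> -[S1 S2].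
- rewrite (card_imset _ old_inj) in S2; have Sn := card_gt1_neq0 S2.
  move: S1; rewrite part_old 1?(imset_subset _ _ old_inj); last by lia.
  move=> S1; rewrite !common_part_old ?card_imset //; try lia.
  move=> S3 S4 S5 S6; split=> //.
  move=> k4 x y xS yS; have := S6 k4 _ _ (imset_f old xS) (imset_f old yS).
  by rewrite !below_part_old ?kf // => /(imset_inj old_inj).
- have Sn := card_gt1_neq0 S2; move=> S3 S4 S5 S6; split; rewrite ?(card_imset _ old_inj) //.
  + rewrite part_old ?imsetS //; lia.
  + rewrite common_part_old ?card_imset //; lia.
  + move=> k3; rewrite common_part_old ?card_imset ?S4 //; lia.
  + by move=> k3; rewrite common_part_old ?card_imset ?S5.
  + move=> k4 _ _ /imsetP[x xS ->] /imsetP[y yS ->].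
    by rewrite !below_part_old ?kf // (S6 k4 x y).
Qed.

Lemma admissible_oldE k (T : {set H'}) : 2 <= k <= nparts H -> admissible k T ->
  exists2 S : {set H}, T = old @: S & admissible k S.
Proof.
move=> kn aT; suff TE : T = old @: (old @^-1: T).
  by exists (old @^-1: T) => //; apply/admissible_old => //; rewrite -TE.
apply/setP => -[x|X]; first by rewrite (mem_imset _ _ old_inj) inE.
rewrite [RHS](_ : _ = false); last by apply/imsetP => -[].
apply/negP => /(subsetP (adm_sub aT)).
by rewrite inE /= => /eqP nk; lia.
Qed.

Lemma upper_old x : upper (old x) = old @: upper x.
Proof.
rewrite /upper below_part_old //; apply: leq_ltn_trans (leq_pred _) (level_lt x).
Qed.

Lemma clean_level_old k : 2 <= k < nparts H -> clean_level H k -> clean_level H' k.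
Proof.
case/andP=> k2 kn [C1 C2 C3 C4 C5].
have kn' : 2 <= k <= nparts H by rewrite k2 ltnW.
have oldE (x : H') : level x = k -> exists2 x0, x = old x0 & level x0 = k.
  by case: x => [x0|X] /= lx; [exists x0 | lia].
have upn x : level x = k -> upper x != set0.
  by move=> /C1/adm_card/card_gt1_neq0.
split.
- by move=> _ /oldE[x -> lx]; rewrite upper_old admissible_old //; apply: C1.
- move=> _ /oldE[x -> lx].
  by rewrite upper_old common_old ?upn // below_old C2 // imsetU.
- move=> _ T /oldE[x -> lx] /(admissible_oldE kn')[S -> aS].
  have Sn := card_gt1_neq0 (adm_card aS).
  rewrite upper_old !common_old ?upn // !(imset_subset _ _ old_inj); exact: C3.
- move=> T /(admissible_oldE kn')[S -> aS].
  have [x lx [sx cx]] := C4 _ aS; have Sn := card_gt1_neq0 (adm_card aS).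
  exists (old x) => //.
  by rewrite upper_old !common_old ?upn // !imsetS.
- move=> _ _ /oldE[x -> lx] /oldE[y -> ly]; rewrite !upper_old => /(imset_inj old_inj) E.
  by rewrite (C5 x y).
Qed.

End AddLevel.

(** * Clean factors and admissible sets *)

Section Vstar.
Variable H : kpartite.
Hypothesis n2 : 2 <= nparts H.
Implicit Types (x : H) (S X : {set H}).

Lemma nbh_below x : x \in part H (nparts H - 1) -> nbh x = below x.
Proof.
rewrite inE => /eqP lx; apply/setP => y; rewrite !inE.
have [xy|//] := boolP (sedge x y); rewrite ltn_neqAle eq_sym level_edge //=.
by rewrite lx leq_subRL ?level_lt //; lia.
Qed.

Lemma bigcap_nbh S : S \subset part H (nparts H - 1) ->
  \bigcap_(x in S) nbh x = common S.
Proof. by move=> /subsetP sS; apply: eq_bigr => x /sS/nbh_below. Qed.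

Lemma common_disjoint S : S \subset part H (nparts H).-1 -> S != set0 ->
  common S :&: part H (nparts H).-1 = set0.
Proof.
move=> /subsetP sS /set0Pn[x xS]; apply/setP => y; rewrite !inE.
apply/negP => /andP[/commonP/(_ _ xS)/level_below ly /eqP ey].
by have := sS _ xS; rewrite inE => /eqP ex; rewrite ex ey ltnn in ly.
Qed.

(** With [bottom_closure], this recovers [S] and [common S] from the closure, so inclusion of
    closures splits into the two inclusions of [clean_level]. *)
Lemma top_closure S : S \subset part H (nparts H).-1 -> S != set0 ->
  (S :|: common S) :&: part H (nparts H).-1 = S.
Proof. by move=> sS Sn; rewrite setIUl common_disjoint // setU0; apply/setIidPl. Qed.

Lemma bottom_closure S : S \subset part H (nparts H).-1 -> S != set0 ->
  (S :|: common S) :\: part H (nparts H).-1 = common S.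
Proof.
move=> sS Sn; rewrite setDUl; move: (sS); rewrite -setD_eq0 => /eqP->.
by rewrite set0U; apply/setDidPl; rewrite -setI_eq0 common_disjoint.
Qed.

Lemma bigcap_nbh_part S i : S \subset part H (nparts H - 1) -> S != set0 ->
  \bigcap_(x in S) nbh_part i x = common S :&: part H i.
Proof.
move=> sS /set0Pn[s sin]; rewrite -bigcap_nbh //; apply/setP => y; rewrite in_setI.
apply/bigcapP/andP => [yS|[/bigcapP yS yi] x xS]; last by rewrite in_setI yS.
split; last by have := yS _ sin; rewrite in_setI => /andP[].
by apply/bigcapP => x /yS; rewrite in_setI => /andP[].
Qed.

Lemma two_common_closure S i : S \subset part H (nparts H).-1 -> S != set0 ->
  two_common i (S :|: common S) = (2 <= #|common S :&: part H i|).
Proof.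
move=> sS Sn; rewrite /two_common /top_part subn1 top_closure //.
by rewrite bigcap_nbh_part ?subn1.
Qed.

Lemma in_Vstar X : (X \in Vstar H) = [&& X \in Vplus H, two_common (nparts H - 2) X,
  (3 <= nparts H) ==> two_common 1 X, (nparts H <= 3) ==> two_common 0 X
  & (4 <= nparts H) ==> same_nbh (frozen_part (nparts H)) X].
Proof.
(* With two parts every neighbour of a top vertex is in part 0, so the size condition of [Vplus]
   already counts there. *)
have twoV0 : nparts H = 2 -> X \in Vplus H -> two_common 0 X.
  move=> nH /imsetP[S]; rewrite inE => /and3P[S1 S2 S3] ->.
  have Sn := card_gt1_neq0 S2; rewrite bigcap_nbh // in S3 *.
  rewrite subn1 in S1; rewrite two_common_closure //.
  apply: leq_trans S3 (subset_leq_card _); apply/subsetP => y yS; rewrite inE yS inE /=.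
  have /set0Pn[s sS] := Sn; have := subsetP S1 _ sS; rewrite inE nH => /eqP ls.
  by move/commonP: yS => /(_ _ sS)/level_below; rewrite ls; case: (level y).
move: n2 twoV0; rewrite /Vstar /frozen_part; case: (nparts H) => [|[|[|[|[|k]]]]] //= _ twoV0.
- by apply/idP/andP => [XV|[]//]; rewrite twoV0.
- by rewrite inE !andbT -[3 - 2]/1; case: (two_common 1 X).
- by rewrite inE.
- by rewrite inE; congr [&& _, _ & _]; rewrite andbC.
Qed.

Lemma VstarP X : X \in Vstar H <->
  exists2 S : {set H}, X = S :|: common S & admissible (nparts H) S.
Proof.
have n1 : nparts H - 1 = (nparts H).-1 by rewrite subn1.
have sameP S i : S \subset part H (nparts H).-1 -> S != set0 ->
    reflect {in S &, forall x y, below x :&: part H i = below y :&: part H i}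
    (same_nbh i (S :|: common S)).
  move=> sS Sn; rewrite /same_nbh /top_part n1 top_closure //.
  have E x : x \in S -> nbh_part i x = below x :&: part H i.
    by move=> /(subsetP sS) xt; rewrite /nbh_part nbh_below ?n1.
  apply: (iffP forall_inP) => [h x y xS yS|h x xS].
    by have /forall_inP/(_ y yS)/eqP := h x xS; rewrite !E.
  by apply/forall_inP => y yS; rewrite !E // (h x y).
rewrite in_Vstar; split=> [/and5P[]|[S -> [S1 S2 S3 S4 S5 S6]]].
  case/imsetP => S; rewrite inE => /and3P[S1 S2 S3] ->.
  have Sn := card_gt1_neq0 S2; rewrite bigcap_nbh //.
  rewrite n1 in S1; rewrite !two_common_closure // => S4 /implyP S5 /implyP S6 /implyP S7.
  exists S => //; split=> // n4; apply/sameP => //; exact: S7.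
have Sn := card_gt1_neq0 S2; rewrite !two_common_closure //; apply/and5P; split=> //.
- rewrite -bigcap_nbh ?n1 //; apply: imset_f; rewrite inE n1 S1 S2 /=.
  rewrite bigcap_nbh ?n1 //; apply: leq_trans S3 _.
  exact/subset_leq_card/subsetIl.
- exact/implyP.
- exact/implyP.
- by apply/implyP => n4; apply/sameP => //; apply: S6.
Qed.

Lemma clean_level_new : clean_level (clean_factor H) (nparts H).
Proof.
pose H' := clean_factor H.
have n22 : 2 <= nparts H <= nparts H by rewrite n2 leqnn.
have oldI : injective (inl : H -> H') by move=> x y [].
have newE (x : H') : level x = nparts H ->
    exists X : {X : {set H} | X \in maximal_sets (Vstar H)}, exists S : {set H},
    [/\ x = inr X, val X = S :|: common S, admissible (nparts H) S
      & forall T, admissible (nparts H) T -> S :|: common S \subset T :|: common T ->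
        T :|: common T = S :|: common S].
  case: x => [x /= lx|X _]; first by have := level_lt x; rewrite lx ltnn.
  have := valP X; rewrite inE => /maxsetP[/VstarP[S XE aS] mX].
  exists X, S; split=> // T aT sT; rewrite -XE; apply: mX; last by rewrite XE.
  by apply/VstarP; exists T.
have closure_sub S T : admissible (nparts H) S -> admissible (nparts H) T ->
    S :|: common S \subset T :|: common T -> S \subset T /\ common S \subset common T.
  move=> aS aT sST; have [aS1 aT1] := (adm_sub aS, adm_sub aT).
  have [Sn Tn] := (card_gt1_neq0 (adm_card aS), card_gt1_neq0 (adm_card aT)).
  split; first by rewrite -(top_closure aS1 Sn) -(top_closure aT1 Tn) setSI.
  by rewrite -(bottom_closure aS1 Sn) -(bottom_closure aT1 Tn) setSD.
have upperE (X : {X : {set H} | X \in maximal_sets (Vstar H)}) S :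
    val X = S :|: common S -> admissible (nparts H) S ->
    @upper H' (inr X) = inl @: S.
  move=> XE aS; rewrite /upper below_new XE part_old /=; last by lia.
  rewrite -imsetI; last by move=> ? ? _ _; apply: oldI.
  by rewrite top_closure ?(adm_sub aS) ?card_gt1_neq0 ?(adm_card aS).
have nz S : admissible (nparts H) S -> S != set0.
  by move=> /adm_card/card_gt1_neq0.
split.
- move=> _ /newE[X [S [-> XE aS mX]]]; rewrite (upperE _ _ XE) //.
  exact/admissible_old.
- move=> _ /newE[X [S [-> XE aS mX]]]; rewrite (upperE _ _ XE) // below_new XE.
  by rewrite common_old ?nz // imsetU.
- move=> _ T /newE[X [S [-> XE aS mX]]] /(admissible_oldE n22)[T0 -> aT].
  rewrite (upperE _ _ XE) // !common_old ?nz // !(imset_subset _ _ oldI) => sST cST.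
  by have [] := closure_sub T0 S aT aS; rewrite // mX // setUSS.
- move=> T /(admissible_oldE n22)[T0 -> aT].
  (* By finiteness the closure of [T0] extends to a maximal element, which is a new vertex. *)
  have [|X mX sX] := @maxset_exists _ [in Vstar H] (T0 :|: common T0).
    by apply/VstarP; exists T0.
  have XA : X \in maximal_sets (Vstar H) by rewrite inE.
  have /VstarP[S XE aS] := maxsetp mX.
  exists (inr (exist _ X XA)) => //; rewrite (upperE _ S) //.
  rewrite !common_old ?nz // !(imset_subset _ _ oldI).
  by apply: closure_sub; rewrite // -XE.
- move=> _ _ /newE[X [S [-> XE aS _]]] /newE[Y [T [-> YE aT _]]].
  rewrite (upperE _ _ XE) // (upperE _ _ YE) // => /(imset_inj oldI) ST.
  by congr inr; apply: val_inj; rewrite XE YE ST.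
Qed.

End Vstar.

(** * Termination of the series *)

Lemma clean_clean_factor (H : kpartite) :
  2 <= nparts H -> clean H -> clean (clean_factor H).
Proof.
move=> n2 cH k /andP[k2]; rewrite ltnS leq_eqVlt => /predU1P[->|kn].
  exact: clean_level_new.
by apply: clean_level_old; rewrite ?k2 //; apply: cH; rewrite k2.
Qed.

Lemma series_invariant (G : sgraph) (i : nat) :
  (exists j : nat, exists H : kpartite,
    [/\ 1 <= j, clean_factor_series G j = Some H & ~~ effective (Vstar H)]) \/
  exists H : kpartite, [/\ clean_factor_series G i.+1 = Some H,
    nparts H = i.+2, clean H, #|part H 1| = #|part (incidence G) 1|
    & 0 < i -> exists x : H, level x = i.+1].
Proof.
elim: i => [|i [?|[H [HE nH cH c1 _]]]]; [right | by left |].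
  (* The incidence graph has two parts, so [clean] is vacuous for it. *)
  by exists (incidence G); split=> // k; rewrite /= andbC; case: k => [|[]].
have [eff|] := boolP (effective (Vstar H)); last first.
  by left; exists i.+1, H.
right; exists (clean_factor H); split.
- by move: HE; rewrite /= => ->; rewrite /= /clean_step eff.
- by rewrite /= nH.
- by apply: clean_clean_factor; rewrite ?nH.
- by rewrite -c1 card_part_old // nH.
- case/set0Pn: eff => X XA _; by exists (inr (exist _ X XA)); rewrite /= nH.
Qed.

Theorem theorem2 (G : sgraph) :
  exists i : nat, exists H : kpartite,
    [/\ 1 <= i, clean_factor_series G i = Some H & ~~ effective (Vstar H)].
Proof.
set m := #|part (incidence G) 1|.
(* Without termination there would be a vertex at level [m + 5], one above the bound of
   [level_bound]. *)
have [//|[H [_ _ cH c1 ex]]] := series_invariant G (m + 4).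
have [|x lx] := ex; first by rewrite addn4.
by have := level_bound cH x; rewrite lx c1 ltnn.
Qed.
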